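(* (Gradient Principle) Let $S\subset\mathbb{R}^n$ be a surface with band $B(S)$ (as in the context), and let $\operatorname{cp}:B(S)\to S$ be a closest point function. Then for every continuously differentiable scalar surface function $u:S\to\mathbb{R}$, $$\nabla[u\circ\operatorname{cp}](y)=\nabla_Su(y)\qquad\text{for all } y\in S,$$ where $\nabla$ is the ordinary gradient in $\mathbb{R}^n$ and $\nabla_S$ the surface gradient.
   Context: Surfaces. $S$ is an embedded $C^2$-submanifold of $\mathbb{R}^n$ without boundary (if there is a boundary, $S$ is identified with its interior), of dimension $k\le n$, possessing a tubular neighborhood $B(S)\subset\mathbb{R}^n$, an open set containing $S$, called a band around $S$. $S$ is orientable in the sense that, if $k<n$, there are smooth unit vector fields $N_1,\dots,N_{n-k}:S\to\mathbb{R}^n$ spanning the normal space $\mathcal{N}_yS$ at each $y\in S$. $\mathcal{T}_yS$ is the tangent space, and $P(y)\in\mathbb{R}^{n\times n}$ is the orthogonal projector of $\mathbb{R}^n$ onto $\mathcal{T}_yS$. Surface gradient. For a $C^1$ function $u:S\to\mathbb{R}$ and $y\in S$, let $u_E:\Omega_E\to\mathbb{R}$ be any $C^1$ extension of $u$ near $y$: $\Omega_E\subset\mathbb{R}^n$ is open, contains $y$, and $u_E=u$ on $S\cap\Omega_E$. Then $\nabla_Su(y)^T:=\nabla u_E(y)^T\cdot P(y)$ (independent of the chosen extension). Closest point function. A map $\operatorname{cp}:B(S)\to S$ is a closest point function if (1) it is a $C^1$-retraction, i.e. $\operatorname{cp}$ is continuously differentiable (as a map into $\mathbb{R}^n$)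 and $\operatorname{cp}(y)=y$ for all $y\in S$; and (2) its Jacobian satisfies $D\operatorname{cp}(y)=P(y)$ for all $y\in S$. *)

(* Defs.v *)
From HB Require Import structures.
From mathcomp Require Import all_boot all_order all_algebra.
From mathcomp Require Import boolp classical_sets functions reals.
From mathcomp Require Import interval_inference topology normedtype derive.

Set Implicit Arguments.
Unset Strict Implicit.
Unset Printing Implicit Defensive.
Import Order.TTheory GRing.Theory Num.Theory.
Import numFieldNormedType.Exports.
Local Open Scope classical_set_scope.
Local Open Scope ring_scope.

(* Points of $\mathbb{R}^n$ are row vectors ['rV[R]_n].  The library norm on
   them is the sup norm; it is only used for the topology and for
   differentiability, while everything metric (orthogonality, unit length) goes
   through [dot].  Maps defined on a subset of a space are total functions whose
   values outside that subset are irrelevant. *)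

Section Regularity.
Context {R : realType}.

(* $f \in C^r(U)$, for [U] open in a finite-dimensional space [V]: in finite
   dimension, continuity of $x \mapsto Df(x)$ amounts to continuity of
   $x \mapsto Df(x)v$ for every $v$. *)
Fixpoint Cr_on (r : nat) (V W : normedModType R) (U : set V) (f : V -> W) :
    Prop :=
  if r is r'.+1 then
    (forall x, U x -> differentiable f x) /\
    (forall v, Cr_on r' U (fun x => 'd f x v))
  else forall x, U x -> {for x, continuous f}.

Definition C1_extension (V W : normedModType R) (A : set V) (f : V -> W)
    (x : V) (O : set V) (fE : V -> W) : Prop :=
  [/\ open O, O x, Cr_on 1 O fE & forall z, A z -> O z -> fE z = f z].

(* $C^1$ on a subset [A] that need not be open (a surface, a bundle). *)
Definition C1_in (V W : normedModType R) (A : set V) (f : V -> W) : Prop :=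
  forall x, A x -> exists O fE, C1_extension A f x O fE.

End Regularity.

Section Surfaces.
Context {R : realType} {n : nat}.
Implicit Types (S B : set 'rV[R]_n) (x y v w : 'rV[R]_n).

Definition dot v w : R := \sum_i v 0 i * w 0 i.

Definition grad (f : 'rV[R]_n -> R) x : 'rV[R]_n :=
  \row_i 'D_(delta_mx 0 i) f x.

(* Slice charts: near each of its points, [S] is carried onto
   $\mathbb{R}^k \times \{0\}$ by a $C^2$-diffeomorphism
   $\varphi : U \to V$ of open sets of $\mathbb{R}^n$, with inverse $\psi$. *)
Definition C2_submanifold (k : nat) S : Prop :=
  forall y, S y -> exists (U V : set 'rV[R]_n) (phi psi : 'rV[R]_n -> 'rV[R]_n),
    [/\ [/\ open U, U y & open V],
        Cr_on 2 U phi /\ Cr_on 2 V psi,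
        forall x, U x -> V (phi x) /\ psi (phi x) = x,
        forall z, V z -> U (psi z) /\ phi (psi z) = z &
        forall x, U x -> (S x <-> forall i : 'I_n, (k <= i)%N -> phi x 0 i = 0)].

Definition tangent_space S y : set 'rV[R]_n :=
  [set v | exists (I : set R) (c : R -> 'rV[R]_n),
    [/\ open I, I 0, Cr_on 1 I c, (forall t, I t -> S (c t)) &
        c 0 = y /\ derive1 c 0 = v]].

Definition normal_space S y : set 'rV[R]_n :=
  [set w | forall v, tangent_space S y v -> dot v w = 0].

Definition normal_bundle S : set ('rV[R]_n * 'rV[R]_n) :=
  [set p | S p.1 /\ normal_space S p.1 p.2].

(* An orthogonal projector is a symmetric matrix, so acting on row vectors
   ($v \mapsto vP$) is the same as acting on columns ($v \mapsto Pv$). *)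
Definition is_orthogonal_projector (T : set 'rV[R]_n) (P : 'M[R]_n) : Prop :=
  forall v, T (v *m P) /\ forall w, T w -> dot (v - v *m P) w = 0.

(* See [tangent_projP] for existence. *)
Definition tangent_proj S y : 'M[R]_n :=
  xget 0 [set P | is_orthogonal_projector (tangent_space S y) P].

(* For $k = n$ there is nothing to require.  The normal bundle of a $C^2$
   submanifold is only $C^1$, hence "smooth" fields are $C^1$ fields. *)
Definition orientable (k : nat) S : Prop :=
  (k < n)%N -> exists N : 'I_(n - k) -> 'rV[R]_n -> 'rV[R]_n,
    [/\ forall i, C1_in S (N i),
        forall i y, S y -> dot (N i y) (N i y) = 1 &
        forall y, S y -> forall w, normal_space S y w <->
          exists a : 'I_(n - k) -> R, w = \sum_i a i *: N i y].

(* [B] is an open set containing [S] that is $C^1$-diffeomorphic, by a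
   diffeomorphism [f] (with inverse [g]) fixing [S] (the zero section), to an
   open neighbourhood, with star-shaped fibres, of the zero section of the
   normal bundle.  This covers the images of a disc bundle
   $\{(y,v) : |v| < \delta(y)\}$ under $(y,v) \mapsto y+v$ as well as more
   general tubes. *)
Definition tubular_nbhd S B : Prop :=
  [/\ open B, S `<=` B &
    exists (W : set ('rV[R]_n * 'rV[R]_n))
           (f : 'rV[R]_n * 'rV[R]_n -> 'rV[R]_n)
           (g : 'rV[R]_n -> 'rV[R]_n * 'rV[R]_n),
      let E := normal_bundle S `&` W in
      [/\ open W,
          forall y, S y -> W (y, 0) /\ f (y, 0) = y,
          forall y v (t : R), E (y, v) -> 0 <= t <= 1 -> W (y, t *: v),
          C1_in E f /\ Cr_on 1 B g &
          (forall p, E p -> B (f p) /\ g (f p) = p) /\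
          (forall x, B x -> E (g x) /\ f (g x) = x)]].

Definition surface (k : nat) S B : Prop :=
  [/\ (k <= n)%N, C2_submanifold k S, orientable k S & tubular_nbhd S B].

(* $\nabla u_E(y)^T P(y)$ for some local $C^1$ extension $u_E$ of $u$; all
   extensions give the same value, see [surface_gradE]. *)
Definition surface_grad S (u : 'rV[R]_n -> R) y : 'rV[R]_n :=
  xget 0 [set g | exists O uE,
    C1_extension S u y O uE /\ g = grad uE y *m tangent_proj S y].

(* The library Jacobian acts on row vectors from the right, i.e. it is the
   transpose of the usual one. *)
Definition closest_point_function S B (cp : 'rV[R]_n -> 'rV[R]_n) : Prop :=
  [/\ forall x, B x -> S (cp x),
      Cr_on 1 B cp,
      forall y, S y -> cp y = y &
      forall y, S y -> ('J cp y)^T = tangent_proj S y].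

End Surfaces.

Section Facts.
Context {R : realType} {n : nat}.
Implicit Types (S B : set 'rV[R]_n) (x y v w : 'rV[R]_n).

Lemma dotC v w : dot v w = dot w v.
Proof. by apply: eq_bigr => i _; rewrite mulrC. Qed.

Lemma dotBl v1 v2 w : dot (v1 - v2) w = dot v1 w - dot v2 w.
Proof.
by rewrite -sumrB; apply: eq_bigr => i _; rewrite !mxE mulrBl.
Qed.

Lemma dotE v w : dot v w = (v *m w^T) 0 0.
Proof. by rewrite mxE; apply: eq_bigr => i _; rewrite !mxE. Qed.

Lemma dot_eq0 v : dot v v = 0 -> v = 0.
Proof.
move=> /eqP; rewrite psumr_eq0 => [/allP v0|i _]; last exact: sqr_ge0.
apply/rowP => i; rewrite mxE; apply/eqP.
by have := v0 i (mem_index_enum _); rewrite -expr2 sqrf_eq0.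
Qed.

Lemma dot_delta v i : dot v (delta_mx 0 i) = v 0 i.
Proof.
rewrite /dot (bigD1 i)//= !mxE !eqxx mulr1 big1 ?addr0// => j ji.
by rewrite !mxE (negPf ji) andbF mulr0.
Qed.

Lemma orthogonal_projector_exists m (A : 'M[R]_(m, n)) :
  exists P, is_orthogonal_projector [set v | (v <= A)%MS] P.
Proof.
have [C Cfree CA] : exists2 C : 'M[R]_(\rank A, n), row_free C & (C :=: A)%MS.
  by exists (row_base A); [exact: row_base_free | exact: eq_row_base].
pose G := C *m C^T.
have Gu : G \in unitmx.
  rewrite -row_free_unit -kermx_eq0; apply/eqP/row_matrixP => i.
  set r := row i _; rewrite row0.
  have rG : r *m G = 0 by apply/sub_kermxP; exact: row_sub.
  have : dot (r *m C) (r *m C) = 0.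
    by rewrite dotE trmx_mul mulmxA -(mulmxA r) rG mul0mx mxE.
  move=> /dot_eq0 rC; apply: (row_free_inj Cfree).
  by rewrite rC mul0mx.
exists (C^T *m invmx G *m C) => v; split=> /=.
  by rewrite mulmxA (submx_trans (submxMl _ _))// CA.
move=> w; rewrite -CA => /submxP[D ->].
rewrite dotE trmx_mul mulmxBl !mulmxA -(mulmxA _ C) -/G mulmxKV//.
by rewrite subrr mxE.
Qed.

Lemma orthogonal_projector_sym (T : set 'rV[R]_n) (P : 'M[R]_n) :
  is_orthogonal_projector T P -> P^T = P.
Proof.
move=> TP; have sym v w : dot (v *m P) w = dot v (w *m P).
  have /eqP := (TP v).2 _ (TP w).1; rewrite dotBl subr_eq0 => /eqP ->.
  have /eqP := (TP w).2 _ (TP v).1; rewrite dotBl subr_eq0 => /eqP.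
  by rewrite dotC => ->; rewrite dotC.
apply/matrixP => i j; rewrite mxE.
have := sym (delta_mx 0 j) (delta_mx 0 i).
by rewrite dot_delta dotC dot_delta -!rowE !mxE.
Qed.

Lemma differentiable_near_open (V W : normedModType R) (f : V -> W) (x : V)
  (O : set W) : differentiable f x -> open O -> O (f x) ->
  \forall z \near x, O (f z).
Proof.
move=> /differentiable_continuous cf oO Ofx.
by apply: cf; exact: open_nbhs_nbhs.
Qed.

Lemma diff_grad (f : 'rV[R]_n -> R) x v :
  differentiable f x -> 'd f x v = dot (grad f x) v.
Proof.
move=> df; rewrite {1}(row_sum_delta v) linear_sum; apply: eq_bigr => i _.
by rewrite linearZ /= mxE deriveE// mulrC.
Qed.

Lemma tangent_spaceE (k : nat) S y : C2_submanifold k S -> S y ->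
  exists A : 'M[R]_n, tangent_space S y = [set v | (v <= A)%MS].
Proof.
move=> mS Sy.
have [U [V [phi [psi [[oU Uy oV] [[dphi _] [dpsi dpsi2]] UV VU US]]]]] := mS _ Sy.
have [Vz0 psiz0] := UV _ Uy.
set z0 := phi y in Vz0 psiz0.
have dpsi0 := dpsi _ Vz0.
exists (pid_mx k *m 'J psi z0); apply/seteqP; split=> v /=.
- move=> [I [c [oI I0 [dc _] Sc [c0 <-]]]].
  have dc0 : differentiable c 0 by exact: dc.
  have dphic : differentiable (phi \o c) 0.
    by apply: differentiable_comp => //; rewrite c0; exact: dphi.
  rewrite derive1E'//.
  pose w := 'd (phi \o c) 0 (1 : R).
  have nU : \forall t \near (0 : R), U (c t).
    by apply: differentiable_near_open => //; rewrite c0.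
  have nI : \forall t \near (0 : R), I t by exact: open_nbhs_nbhs.
  have wk (i : 'I_n) : (k <= i)%N -> w 0 i = 0.
    move=> ki.
    have dco (M : 'rV[R]_n) : differentiable (fun N : 'rV[R]_n => N 0 i) M.
      exact: differentiable_coord.
    have -> : w 0 i = 'D_1 ((fun N : 'rV[R]_n => N 0 i) \o (phi \o c)) (0 : R).
      by rewrite /w -deriveE// derive_mx ?mxE//; exact: diff_derivable.
    rewrite (@near_eq_derive _ _ _ _ (cst 0)) ?derive_cst//.
    near=> t; rewrite /=; have Ut : U (c t) by near: t.
    by apply: (US _ Ut).1 => //; apply: Sc; near: t.
  have -> : 'd c 0 (1 : R) = w *m 'J psi z0.
    rewrite -deriveE// (@near_eq_derive _ _ _ _ (psi \o (phi \o c))).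
      rewrite deriveE; last by apply: differentiable_comp; rewrite //= c0.
      by rewrite diff_comp//= ?c0// /w /jacobian mul_rV_lin1.
    near=> t; have Ut : U (c t) by near: t.
    by rewrite /= (UV _ Ut).2.
  have -> : w = w *m pid_mx k.
    apply/rowP => j; rewrite mxE (bigD1 j)//= big1 => [|i ij].
      rewrite !mxE eqxx /= addr0; case: ltnP => kj; first by rewrite mulr1.
      by rewrite mulr0 wk.
    by rewrite !mxE -val_eqE in ij *; rewrite (negPf ij) mulr0.
  by rewrite -mulmxA submxMl.
- move=> /submxP[d ->]; rewrite mulmxA.
  pose w : 'rV[R]_n := d *m pid_mx k.
  have wk (i : 'I_n) : (k <= i)%N -> w 0 i = 0.
    move=> ki; rewrite mxE big1// => j _; rewrite !mxE.
    case: eqVneq => [ji|]; last by rewrite mulr0.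
    by rewrite ji ltnNge ki mulr0.
  pose a (t : R) : 'rV[R]_n := z0 + t *: w.
  have da (t : R) : is_diff t a (fun s : R => s *: w).
    have sw : is_diff t (fun s : R => s *: w) (fun s : R => s *: w).
      exact: is_diff_scalel.
    have cz := @is_diff_cst _ R^o 'rV[R]_n z0 t.
    by have := is_diffD cz sw; rewrite add0r.
  have ca : continuous a.
    by move=> t; apply: differentiable_continuous; case: (da t).
  have a0 : a 0 = z0 by rewrite /a scale0r addr0.
  have dpa (t : R) : V (a t) -> is_diff t (psi \o a) ('d psi (a t) \o (fun s : R => s *: w)).
    by move=> Vt; apply: is_diff_comp; exact/differentiableP/dpsi.
  exists (a @^-1` V), (psi \o a); split.
  + exact: open_comp.
  + by rewrite /= a0.
  + split=> [t Vt|h t Vt]; first by case: (dpa t Vt).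
    pose g s := 'd psi (a s) (h *: w).
    have gE s : V (a s) -> 'd (psi \o a) s h = g s.
      by move=> /dpa[_ ->].
    have cg : {for t, continuous g}.
      apply: (@continuous_comp _ _ _ a (fun z => 'd psi z (h *: w))).
        exact: ca.
      by apply: differentiable_continuous; exact: (dpsi2 _).1.
    have nV : \forall s \near t, V (a s) by apply: ca; exact: open_nbhs_nbhs.
    have near_cont (f : R -> 'rV[R]_n) : (forall s, V (a s) -> f s = g s) ->
        {for t, continuous f}.
      move: (g) cg => g' cg fg; rewrite /prop_for /continuous_at (fg _ Vt).
      apply: cvg_trans cg; apply: near_eq_cvg.
      by apply: filterS nV => s Vs; rewrite fg.
    exact: near_cont gE.
  + move=> t Vt; have [Ut phia] := VU _ Vt.
    apply/(US _ Ut) => i ki; rewrite /= phia mxE [X in _ + X]mxE wk// mulr0 addr0.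
    exact: (US _ Uy).1.
  + rewrite /= a0; split=> //.
    have V0 : V (a 0) by rewrite a0.
    have [dp0 dp0E] := dpa 0 V0.
    by rewrite derive1E'// dp0E /= scale1r a0 /jacobian mul_rV_lin1.
Unshelve. all: by end_near. Qed.

Lemma tangent_projP (k : nat) S y : C2_submanifold k S -> S y ->
  is_orthogonal_projector (tangent_space S y) (tangent_proj S y).
Proof.
move=> mS Sy.
have ex : exists P, is_orthogonal_projector (tangent_space S y) P.
  by have [A ->] := tangent_spaceE mS Sy; exact: orthogonal_projector_exists.
exact: (xgetPex 0 ex).
Qed.

Lemma C1_extension_grad_tangent S u y O1 O2 uE1 uE2 v :
  C1_extension S u y O1 uE1 -> C1_extension S u y O2 uE2 ->
  tangent_space S y v -> dot (grad uE1 y) v = dot (grad uE2 y) v.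
Proof.
move=> [oO1 O1y [d1 _] e1] [oO2 O2y [d2 _] e2] [I [c [oI I0 [dc _] Sc [c0 <-]]]].
have dc0 : differentiable c 0 by exact: dc.
have {}d1 : differentiable uE1 (c 0) by rewrite c0; exact: d1.
have {}d2 : differentiable uE2 (c 0) by rewrite c0; exact: d2.
rewrite derive1E'// -c0 -(diff_grad _ d1) -(diff_grad _ d2).
have dE (f : 'rV[R]_n -> R) : differentiable f (c 0) ->
    'd f (c 0) ('d c 0 (1 : R)) = 'D_1 (f \o c) (0 : R).
  move=> df; rewrite deriveE; last exact: differentiable_comp.
  by rewrite (diff_comp dc0 df).
rewrite (dE _ d1) (dE _ d2); apply: near_eq_derive.
have nI : \forall t \near (0 : R), I t by exact: open_nbhs_nbhs.
have n1 : \forall t \near (0 : R), O1 (c t).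
  by apply: differentiable_near_open => //; rewrite c0.
have n2 : \forall t \near (0 : R), O2 (c t).
  by apply: differentiable_near_open => //; rewrite c0.
near=> t; rewrite /=.
have It : I t by near: t.
rewrite e1 ?e2//; [exact: Sc|by near: t|exact: Sc|by near: t].
Unshelve. all: by end_near. Qed.

Lemma surface_gradE (k : nat) S (u : 'rV[R]_n -> R) y O uE :
  C2_submanifold k S -> S y -> C1_extension S u y O uE ->
  surface_grad S u y = grad uE y *m tangent_proj S y.
Proof.
move=> mS Sy uEP; rewrite /surface_grad.
have TP := tangent_projP mS Sy.
case: xgetP => [_ _ [O' [uE' [uEP' ->]]]|]; last first.
  by move=> /(_ (grad uE y *m tangent_proj S y)) []; exists O, uE.
apply/rowP => j; rewrite -(orthogonal_projector_sym TP).
have mulE v : (v *m (tangent_proj S y)^T) 0 j =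
    dot v (delta_mx 0 j *m tangent_proj S y).
  by rewrite mxE -rowE; apply: eq_bigr => i _; rewrite !mxE.
rewrite !mulE; apply: (C1_extension_grad_tangent uEP' uEP).
exact: (TP _).1.
Qed.

End Facts.

(* Main.v *)
Require Import Defs.
From HB Require Import structures.
From mathcomp Require Import all_boot all_order all_algebra.
From mathcomp Require Import boolp classical_sets functions reals.
From mathcomp Require Import interval_inference topology normedtype derive.
From mathcomp Require Import landau.

Import Order.TTheory GRing.Theory Num.Theory.
Import numFieldNormedType.Exports.
Local Open Scope classical_set_scope.
Local Open Scope ring_scope.

(** Since [cp] takes its values in [S] and fixes [y], [u \o cp] agrees near [y]
    with [uE \o cp] for any local $C^1$ extension [uE] of [u]; the chain rule
    then multiplies the gradient of [uE] at [y] by the Jacobian of [cp], which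
    is the tangential projector. *)

(** Differentiability depends only on the germ at [x]: the expansion of [f] with linear part
    ['d f x] is also one of [g], with the same remainder near [0]. *)
Lemma near_eq_differentiable (R : realType) (V W : normedModType R)
    (f g : V -> W) (x : V) :
  (\near x, f x = g x) -> differentiable f x -> differentiable g x.
Proof.
move=> fg df; have fgx : f x = g x := nbhs_singleton fg.
have gE : g \o shift x = cst (g x) + 'd f x +o_ 0 id.
  apply/eqaddoP => _ /posnumP[e].
  have /eqaddoP/(_ e%:num (gt0 e)) fo := diff_locally df.
  have fg0 : \forall h \near 0, f (h + x) = g (h + x).
    by move: fg; rewrite (near_shift 0) subr0.
  by apply: filterS2 fo fg0 => h /=; rewrite !fctE /= fgx => + <-.
(* Uniqueness of the linear part in [gE] replaces ['d g x] by ['d f x]. *)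
apply/diff_locallyP; rewrite (diff_unique (diff_continuous df) gE).
by split=> //; exact: diff_continuous.
Qed.

(** Chain rule for row vectors; the transpose arises because ['J g x] acts from the right, so its
    [i]-th row is the [i]-th partial derivative of [g]. *)
Lemma grad_comp (R : realType) (n : nat) (f : 'rV[R]_n -> R)
    (g : 'rV[R]_n -> 'rV[R]_n) (x : 'rV[R]_n) :
  differentiable g x -> differentiable f (g x) ->
  grad (f \o g) x = grad f (g x) *m ('J g x)^T.
Proof.
move=> dg df; apply/rowP => i.
rewrite mxE deriveE; last exact: differentiable_comp.
rewrite diff_comp//= diff_grad// !mxE; apply: eq_bigr => j _.
by rewrite !mxE.
Qed.

Theorem mainTheorem3 (R : realType) (n k : nat) (S B : set 'rV[R]_n)
    (cp : 'rV[R]_n -> 'rV[R]_n) (u : 'rV[R]_n -> R) :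
  surface k S B ->
  closest_point_function S B cp ->
  C1_in S u ->
  forall y, S y ->
    differentiable (u \o cp) y /\
    grad (u \o cp) y = surface_grad S u y.
Proof.
move=> [_ mS _ [oB SB _]] [cpS [dcp _] cpK Jcp] uC1 y Sy.
have [Om [uE uEP]] := uC1 y Sy; have [oO Oy [duE _] uEu] := uEP.
have dcpy : differentiable cp y by exact/dcp/SB.
have duEcp : differentiable uE (cp y) by rewrite cpK//; exact: duE.
have uEcp : \forall z \near y, (uE \o cp) z = (u \o cp) z.
  (* [uE] and [u] agree at [cp z] once [z] is in [B], which puts [cp z] in [S], and [cp z] is in
     [Om]. *)
  have nB : \forall z \near y, B z by exact: open_nbhs_nbhs (conj oB (SB _ Sy)).
  have nO : \forall z \near y, Om (cp z).
    by apply: differentiable_near_open => //; rewrite cpK.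
  by apply: filterS2 nB nO => z Bz Oz /=; rewrite uEu//; exact: cpS.
split.
  (* Off [S] the values of [u] are arbitrary, so the chain rule is applied to [uE] and
     transferred. *)
  by apply: near_eq_differentiable uEcp _; exact: differentiable_comp.
(* Only the base point of [grad uE] becomes [cp y], to match the right-hand side of [grad_comp]. *)
rewrite (surface_gradE mS Sy uEP) -(Jcp _ Sy) -[in grad uE _](cpK _ Sy).
rewrite -grad_comp//; apply/rowP => i; rewrite !mxE.
by apply: near_eq_derive; apply: filterS uEcp => z.
Qed.
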